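(* Let $\overline\rho,\overline\theta,\overline p_\rho,\overline p_\theta,\overline e_\theta,\overline k,\overline\alpha>0$ be constants and $\overline u\in\mathbb{R}$. The linearized one-dimensional Euler--Fourier--Korteweg system for $U=(\rho,u,\theta)^\top\in\mathbb{R}^3$, $x\in\mathbb{R}$, $$\rho_t+\overline u\rho_x+\overline\rho u_x=0,$$ $$\overline\rho u_t+\overline p_\rho\rho_x+\overline\rho\,\overline u u_x+\overline p_\theta\theta_x=\overline k\,\overline\rho\,\rho_{xxx},$$ $$\overline\rho\,\overline e_\theta\theta_t+\overline\theta\,\overline p_\theta u_x+\overline\rho\,\overline u\,\overline e_\theta\theta_x=\overline\alpha\theta_{xx},$$ is genuinely coupled and symbol symmetrizable.
   Context: The system is the linearization around a constant state $(\overline\rho,\overline u,\overline\theta)$ of the inviscid heat conducting compressible fluid with capillarity; overlined quantities are values at that state. After division by the constants multiplying the time derivatives the system has the form $U_t+\sum_{k\le m}L_k\partial_x^kU=0$ with constant real $n\times n$ matrices. For $\xi\in\mathbb{R}\setminus\{0\}$ put $A(\xi)=\sum_{k\text{ odd}}(-1)^{(k-1)/2}\xi^{k-1}L_k$ and $B(\xi)=\sum_{k\text{ even}}(-1)^{k/2}\xi^kL_k$ (so $\widehat U_t+i\xi A\widehat U+B\widehat U=0$). Symbol symmetrizable: there is $S\in C^\infty(\mathbb{R}\setminus\{0\};\mathbb{R}^{n\times n})$ with $S(\xi)$ symmetric positive definite, $S(\xi)A(\xi)$ and $S(\xi)B(\xi)$ symmetric and $S(\xi)B(\xi)\ge0$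 for all $\xi\neq0$. Genuinely coupled: for every $\xi\ne0$, $(\mu I_n+A(\xi))\psi\ne0$ for every $\mu\in\mathbb{R}$ and every $\psi\in\ker B(\xi)$, $\psi\ne0$. *)

(* Defs.v *)
From HB Require Import structures.
From mathcomp Require Import all_boot all_order all_algebra.
From mathcomp Require Import all_classical all_reals all_analysis.
From mathcomp Require Import ring.

Set Implicit Arguments.
Unset Strict Implicit.
Unset Printing Implicit Defensive.

Import Order.TTheory GRing.Theory Num.Theory.
Import numFieldNormedType.Exports.

Local Open Scope classical_set_scope.
Local Open Scope ring_scope.

Section Symbols.
Variables (R : realType) (n m : nat).

(* The coefficients of U_t + \sum_(k <= m) L_k d_x^k U = 0; only the values
   L 0, ..., L m of the sequence are used. *)
Implicit Type L : nat -> 'M[R]_n.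

Definition symbolA L (xi : R) : 'M[R]_n :=
  \sum_(k < m.+1 | odd k) ((-1) ^+ k.-1./2 * xi ^+ k.-1) *: L k.

Definition symbolB L (xi : R) : 'M[R]_n :=
  \sum_(k < m.+1 | ~~ odd k) ((-1) ^+ k./2 * xi ^+ k) *: L k.

Definition posdefmx (M : 'M[R]_n) : Prop :=
  M \is symmetricmx /\
  forall v : 'cV[R]_n, v != 0 -> 0 < (v^T *m M *m v) ord0 ord0.

Definition possemidefmx (M : 'M[R]_n) : Prop :=
  M \is symmetricmx /\
  forall v : 'cV[R]_n, 0 <= (v^T *m M *m v) ord0 ord0.

(* Each entry is C^oo on R \ {0}.  The set is open, so the values at 0 of S
   and of the total functions [derive1n k _] are irrelevant. *)
Definition smooth_off0 (S : R -> 'M[R]_n) : Prop :=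
  forall (i j : 'I_n) (k : nat) (xi : R), xi != 0 ->
    derivable (derive1n k (fun z => S z i j)) xi 1.

Definition symbol_symmetrizable L : Prop :=
  exists S : R -> 'M[R]_n, smooth_off0 S /\
    forall xi : R, xi != 0 ->
      [/\ posdefmx (S xi),
          S xi *m symbolA L xi \is symmetricmx
        & possemidefmx (S xi *m symbolB L xi)].

Definition genuinely_coupled L : Prop :=
  forall xi : R, xi != 0 -> forall (mu : R) (psi : 'cV[R]_n),
    symbolB L xi *m psi = 0 -> psi != 0 ->
    (mu%:M + symbolA L xi) *m psi != 0.

End Symbols.

Section EulerFourierKorteweg.
Variable R : realType.

Definition mx3 (rows : seq (seq R)) : 'M[R]_3 :=
  \matrix_(i < 3, j < 3) nth 0 (nth [::] rows i) j.

(* The constant reference state (rho, u, theta) and, at that state, the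
   derivatives of pressure and internal energy, the capillarity kappa and the
   heat conductivity alpha (the overlined quantities, overlines dropped). *)
Variables (rho u theta p_rho p_theta e_theta kappa alpha : R).

(* Row i of the system reads
   efk_time i * d_t U_i + \sum_(k <= 3) (efk_space k d_x^k U)_i = 0. *)
Definition efk_time : 'cV[R]_3 :=
  \col_(i < 3) nth 0 [:: 1; rho; rho * e_theta] i.

Definition efk_space (k : nat) : 'M[R]_3 :=
  match k with
  | 1 => mx3 [:: [:: u;     rho;             0];
                 [:: p_rho; rho * u;         p_theta];
                 [:: 0;     theta * p_theta; rho * u * e_theta]]
  | 2 => mx3 [:: [:: 0; 0; 0];
                 [:: 0; 0; 0];
                 [:: 0; 0; - alpha]]
  | 3 => mx3 [:: [:: 0;               0; 0];
                 [:: - (kappa * rho); 0; 0];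
                 [:: 0;               0; 0]]
  | _ => 0
  end.

(* Division of each equation by the constant in front of its time derivative;
   see [efk_systemE]. *)
Definition efk_L (k : nat) : 'M[R]_3 :=
  \matrix_(i < 3, j < 3) (efk_space k i j / efk_time i ord0).

(* The functions r, v, w of (t, x) are the density, velocity and temperature
   components of U. *)
Definition efk_system (r v w : R -> R -> R) (t x : R) : Prop :=
  let dt (f : R -> R -> R) := derive1 (fun s => f s x) t in
  let dx k (f : R -> R -> R) := derive1n k (f t) x in
  [/\ dt r + u * dx 1 r + rho * dx 1 v = 0,
      rho * dt v + p_rho * dx 1 r + rho * u * dx 1 v + p_theta * dx 1 w
        = kappa * rho * dx 3 r
    & rho * e_theta * dt w + theta * p_theta * dx 1 v
        + rho * u * e_theta * dx 1 w
      = alpha * dx 2 w].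

Lemma efk_L_sum (D : nat -> nat -> R) (i : 'I_3) :
  rho != 0 -> e_theta != 0 ->
  \sum_(k < 4) \sum_(j < 3) efk_L k i j * D k j =
  nth 0 [:: u * D 1 0 + rho * D 1 1;
            (p_rho * D 1 0 + rho * u * D 1 1 + p_theta * D 1 2
              - kappa * rho * D 3 0) / rho;
            (theta * p_theta * D 1 1 + rho * u * e_theta * D 1 2
              - alpha * D 2 2) / (rho * e_theta)] i.
Proof.
move=> rho0 e0.
have LE k (j : 'I_3) : efk_L k i j = efk_space k i j
    / nth 0 [:: 1; rho; rho * e_theta] i by rewrite !mxE.
have mE rows (j : 'I_3) : mx3 rows i j = nth 0 (nth [::] rows i) j.
  by rewrite mxE.
rewrite !big_ord_recl !big_ord0 !LE /efk_space !lift0 /= !mE !mxE /=.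
by case: i {LE mE} => -[|[|[|//]]] ? /=; field; rewrite ?rho0 ?e0.
Qed.

Lemma efk_systemE (r v w : R -> R -> R) (t x : R) :
  rho != 0 -> e_theta != 0 ->
  let U (i : 'I_3) := nth r [:: r; v; w] i in
  efk_system r v w t x <->
  \col_i derive1 (fun s => U i s x) t
    + \sum_(k < 4) efk_L k *m \col_i derive1n k (U i t) x = 0.
Proof.
move=> rho0 e0 U.
pose T i := derive1 (fun s => nth r [:: r; v; w] i s x) t.
pose D k i := derive1n k (nth r [:: r; v; w] i t) x.
have colE (i : 'I_3) j : (\col_i derive1 (fun s => U i s x) t
      + \sum_(k < 4) efk_L k *m \col_i derive1n k (U i t) x) i j =
    T i + \sum_(k < 4) \sum_(j < 3) efk_L k i j * D k j.
  rewrite mxE summxE mxE; congr (_ + _); apply: eq_bigr => k _.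
  by rewrite mxE; apply: eq_bigr => l _; congr (_ * _); rewrite mxE.
have -> : efk_system r v w t x <->
  [/\ T 0 + u * D 1 0 + rho * D 1 1 = 0,
      rho * T 1 + p_rho * D 1 0 + rho * u * D 1 1 + p_theta * D 1 2
        = kappa * rho * D 3 0
    & rho * e_theta * T 2 + theta * p_theta * D 1 1
        + rho * u * e_theta * D 1 2 = alpha * D 2 2] by [].
move: T D colE => T D colE.
have div0 (a c z : R) : c != 0 -> (a + z / c = 0) <-> (c * a + z = 0).
  move=> c0; have -> : a + z / c = (c * a + z) / c by field.
  split=> [/eqP|->]; last by rewrite mul0r.
  by rewrite mulf_eq0 invr_eq0 (negbTE c0) orbF => /eqP.
have re0 : rho * e_theta != 0 by rewrite mulf_neq0.
split=> [[E0 E1 E2]|/matrixP E].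
  apply/matrixP => i j; rewrite colE efk_L_sum // mxE.
  case: i => -[|[|[|//]]] ? /=; first by rewrite addrA.
  - by apply/div0; rewrite // !addrA E1 subrr.
  - by apply/div0; rewrite // !addrA E2 subrr.
have Ei (i : 'I_3) : T i + \sum_(k < 4) \sum_(j < 3) efk_L k i j * D k j = 0.
  by rewrite -(colE i ord0) E mxE.
move: (Ei (@Ordinal 3 0 isT)) (Ei (@Ordinal 3 1 isT)) (Ei (@Ordinal 3 2 isT)).
rewrite !efk_L_sum // => {E Ei} /= + /div0 -/(_ rho0) + /div0 -/(_ re0).
by rewrite !addrA => E0 /subr0_eq E1 /subr0_eq E2; split.
Qed.

End EulerFourierKorteweg.

(* Main.v *)
Require Import Defs.
From mathcomp Require Import all_boot all_order all_algebra.
From mathcomp Require Import all_classical all_reals all_analysis.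
From mathcomp Require Import ring.

Import Order.TTheory GRing.Theory Num.Theory.
Local Open Scope ring_scope.

(* B(xi) = diag (0, 0, xi^2 alpha / (rho e_theta)) has kernel {psi_2 = 0}; the
   third row of (mu + A(xi)) psi = 0 then kills psi_1 and the second row kills
   psi_0.  Since A(xi) is tridiagonal and opposite off-diagonal entries have
   the same sign, it has a diagonal positive symmetrizer, unique up to scaling:
   diag ((p_rho + kappa rho xi^2) / rho, rho, rho e_theta / theta), which is
   polynomial in xi. *)

Lemma symmetricmxP (K : fieldType) (n : nat) (M : 'M[K]_n) :
  reflect (M^T = M) (M \is symmetricmx).
Proof.
by rewrite qualifE /= expr0 scale1r map_mx_id // eq_sym; apply: eqP.
Qed.

Section Diagonal.
Variables (R : realType) (n : nat).
Implicit Type d : 'rV[R]_n.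

Lemma diag_mx_form d (v : 'cV[R]_n) :
  (v^T *m diag_mx d *m v) ord0 ord0 = \sum_i d ord0 i * v i ord0 ^+ 2.
Proof.
rewrite -mulmxA mul_diag_mx mxE; apply: eq_bigr => i _.
by rewrite !mxE mulrCA expr2.
Qed.

Lemma possemidefmx_diag d :
  (forall i, 0 <= d ord0 i) -> possemidefmx (diag_mx d).
Proof.
move=> d_ge0; split=> [|v]; first by apply/symmetricmxP; exact: tr_diag_mx.
by rewrite diag_mx_form sumr_ge0 // => i _; rewrite mulr_ge0 // sqr_ge0.
Qed.

Lemma posdefmx_diag d : (forall i, 0 < d ord0 i) -> posdefmx (diag_mx d).
Proof.
move=> d_gt0; split=> [|v v0]; first by apply/symmetricmxP; exact: tr_diag_mx.
have [i vi0] : exists i, v i ord0 != 0 by apply/cV0Pn.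
rewrite diag_mx_form (bigD1 i) //= ltr_wpDr //.
  by apply: sumr_ge0 => j _; rewrite mulr_ge0 ?sqr_ge0 // ltW.
by rewrite mulr_gt0 // exprn_even_gt0.
Qed.

End Diagonal.

Lemma derive1n_horner (R : realType) (p : {poly R}) (k : nat) :
  derive1n k (horner p) = horner (derivn k p).
Proof.
elim: k => [|k IH]; first by rewrite derivn0.
by rewrite derive1nS IH -derivE derivnS.
Qed.

(** Iterated derivatives of a polynomial are again polynomials, hence derivable everywhere. This
    settles the smoothness of the symmetrizer once its entries are polynomials in [xi]. *)
Lemma smooth_off0_horner (R : realType) (n : nat) (P : 'M[{poly R}]_n) :
  smooth_off0 (fun xi => map_mx (horner_eval xi) P).
Proof.
move=> i j k xi _.
rewrite (_ : (fun z => _) = horner (P i j)); last first.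
  by apply/funext => z; rewrite mxE.
by rewrite derive1n_horner; exact: derivable_horner.
Qed.

Section EfkSymbols.
Variables (R : realType).
Variables (rho u theta p_rho p_theta e_theta kappa alpha : R).
Hypotheses (rho0 : rho != 0) (e0 : e_theta != 0).
Let L := efk_L rho u theta p_rho p_theta e_theta kappa alpha.

(** The sign $(-1)^1$ of the third-order term cancels the minus sign of the capillarity coefficient,
    so [kappa] adds to the pressure term instead of competing with it. *)
Lemma efk_symbolA (xi : R) :
  symbolA 3 L xi =
  mx3 [:: [:: u; rho; 0];
          [:: p_rho / rho + kappa * xi ^+ 2; u; p_theta / rho];
          [:: 0; theta * p_theta / (rho * e_theta); u]].
Proof.
apply/matrixP => i j; rewrite /symbolA big_mkcond !big_ord_recl big_ord0 /=.
rewrite /L /efk_L /efk_space /efk_time !mxE.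
by case: i => -[|[|[|//]]] ?; case: j => -[|[|[|//]]] ? /=; field;
  rewrite ?rho0 ?e0.
Qed.

Lemma efk_symbolB (xi : R) :
  symbolB 3 L xi =
  diag_mx (\row_j [:: 0; 0; xi ^+ 2 * (alpha / (rho * e_theta))]`_j).
Proof.
apply/matrixP => i j; rewrite /symbolB big_mkcond !big_ord_recl big_ord0 /=.
rewrite /L /efk_L /efk_space /efk_time !mxE.
by case: i => -[|[|[|//]]] ?; case: j => -[|[|[|//]]] ? /=;
  rewrite ?mulr0n ?mulr1n; field; rewrite ?rho0 ?e0.
Qed.

End EfkSymbols.

Theorem proposition5p14 (R : realType)
    (rho u theta p_rho p_theta e_theta kappa alpha : R)
    (rho_gt0 : 0 < rho) (theta_gt0 : 0 < theta)
    (p_rho_gt0 : 0 < p_rho) (p_theta_gt0 : 0 < p_theta)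
    (e_theta_gt0 : 0 < e_theta) (kappa_gt0 : 0 < kappa)
    (alpha_gt0 : 0 < alpha) :
  let L := efk_L rho u theta p_rho p_theta e_theta kappa alpha in
  genuinely_coupled 3 L /\ symbol_symmetrizable 3 L.
Proof.
move=> L.
have rho0 := lt0r_neq0 rho_gt0; have e0 := lt0r_neq0 e_theta_gt0.
have theta0 := lt0r_neq0 theta_gt0.
(* This is both the entry of $A(\xi)$ that kills $\psi_0$ and the first diagonal entry of the
   symmetrizer. *)
have coef_gt0 xi : 0 < p_rho / rho + kappa * xi ^+ 2.
  by rewrite ltr_pwDl ?divr_gt0 // mulr_ge0 ?sqr_ge0 // ltW.
split=> [xi xi0 mu psi|].
  have xi2_gt0 : 0 < xi ^+ 2 by rewrite exprn_even_gt0.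
  rewrite efk_symbolA // efk_symbolB // mul_diag_mx.
  (* Indexing by naturals identifies coordinates whose ordinals differ only in their bound
     proofs. *)
  pose p k := psi (inord k) ord0.
  have pE (i : 'I_3) j : psi i j = p i by rewrite /p inord_val ord1.
  move=> /matrixP/(_ (inord 2) ord0).
  rewrite !mxE pE inordK //= => /eqP; rewrite mulf_eq0 => /orP[|/eqP p2].
    by rewrite gt_eqF // mulr_gt0 // divr_gt0 // mulr_gt0.
  apply: contraNneq => /matrixP A0.
  (* In each row used, [mu] and [u] multiply only a coordinate already known to vanish, so the value
     of [mu] is immaterial. *)
  have p1 : p 1 = 0.
    move: (A0 (@Ordinal 3 2 isT) ord0); rewrite !mxE !big_ord_recl big_ord0 !mxE !pE /=.
    rewrite p2 !(mulr0n, mul0r, mulr0, add0r, addr0) => /eqP.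
    by rewrite mulf_eq0 gt_eqF ?divr_gt0 ?mulr_gt0 //= => /eqP.
  have p0 : p 0 = 0.
    move: (A0 (@Ordinal 3 1 isT) ord0); rewrite !mxE !big_ord_recl big_ord0 !mxE !pE /=.
    rewrite p1 p2 !(mulr0n, mul0r, mulr0, add0r, addr0) => /eqP.
    by rewrite mulf_eq0 gt_eqF //= => /eqP.
  by apply/eqP/matrixP => i j; rewrite pE mxE; case: i => -[|[|[|//]]] ?.
(* The entries solve $s_0A_{01}=s_1A_{10}$ and $s_1A_{12}=s_2A_{21}$, normalized by $s_1=\rho$. *)
exists (fun xi => map_mx (horner_eval xi) (diag_mx (\row_j
  [:: (p_rho / rho)%:P + kappa *: 'X^2; rho%:P; (rho * e_theta / theta)%:P]`_j))).
split; first exact: smooth_off0_horner.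
move=> xi xi0.
set S := map_mx _ _.
have SE : S = diag_mx (\row_j [:: p_rho / rho + kappa * xi ^+ 2; rho;
    rho * e_theta / theta]`_j).
  rewrite /S map_diag_mx; congr diag_mx; apply/rowP => j; rewrite !mxE.
  by case: j => -[|[|[|//]]] ? /=; rewrite /horner_eval !hornerE.
rewrite SE {S SE}; split.
- by apply: posdefmx_diag => -[[|[|[|//]]] ?]; rewrite mxE //= ?divr_gt0 ?mulr_gt0.
- apply/symmetricmxP/matrixP => i j; rewrite efk_symbolA // mul_diag_mx !mxE.
  by case: i => -[|[|[|//]]] ?; case: j => -[|[|[|//]]] ? /=; field;
    rewrite ?rho0 ?theta0 ?e0.
(* Both factors are diagonal; the only nonzero entry of the product is $\xi^2\alpha/\theta$. *)
- rewrite efk_symbolB // mulmx_diag; apply: possemidefmx_diag => i.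
  rewrite !mxE; case: i => -[|[|[|//]]] ? /=; rewrite ?mulr0 //.
  by rewrite !(sqr_ge0, invr_ge0, mulr_ge0) // ltW.
Qed.
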